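(* Suppose (F), (N) and (W) of the context hold and the stepsize $\alpha>0$ satisfies $$\alpha<\min\left\{\frac1{\mu+L},\ \frac{1-\rho_w^2}{8d_IL},\ \sqrt{\frac{2d_3}{d_2+\sqrt{d_2^2+4d_1d_3}}}\right\},$$ where $d_1=\frac{128L^6d_I^2}{\mu(1-\rho_w^2)^2}$, $d_2=8\mu L^2d_I^2+\frac{128\mu d_I^2L^2}{(1-\rho_w^2)^2}$, $d_3=\frac{\mu(1-\rho_w^2)^2}{4}$. Then the differential-privacy induced optimization error $\theta$ (defined in the context) of the algorithm in the context, run with $\gamma_k=\beta_k=1$, increases monotonically with increases in the spectral radius $\rho_w=\rho(W-\frac{\boldsymbol{1}\boldsymbol{1}^T}{n})$ and in the spectral radius $\rho(W_o)$ of $W_o$, i.e. $$\frac{\partial\theta}{\partial\rho_w}>0,\qquad \frac{\partial\theta}{\partial\rho(W_o)}\ge0.$$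
   Context: Setting: $n$ agents minimize $f=\frac1n\sum_{i=1}^nf_i$, with $f_i:\mathbb{R}^r\to\mathbb{R}$ the differentiable local objective of agent $i$. (F) Each $f_i$ is $\mu$-strongly convex with $L$-Lipschitz continuous gradient: for all $x,x'\in\mathbb{R}^r$, $\langle\nabla f_i(x)-\nabla f_i(x'),x-x'\rangle\ge\mu\|x-x'\|^2$ and $\|\nabla f_i(x)-\nabla f_i(x')\|\le L\|x-x'\|$. Then $f$ has a unique minimizer $x^\ast$. (W) $W=[w_{ij}]\in\mathbb{R}^{n\times n}$ is entrywise nonnegative, doubly stochastic and symmetric, $w_{ii}>0$ for all $i$, and the undirected graph on $\{1,\dots,n\}$ with an edge between $i$ and $j$ whenever $w_{ij}>0$ is connected. (N) The elements of the random sequences $\{\boldsymbol\eta_k\}$, $\{\boldsymbol\xi_k\}$ in $\mathbb{R}^{n\times r}$ are independent along iterations $k$, across agents (rows), and across state dimensions (columns), with $\mathbb{E}[\boldsymbol\eta_k]=\mathbb{E}[\boldsymbol\xi_k]=\boldsymbol0$, $\mathbb{E}[\|\boldsymbol\eta_k\|^2]\le\sigma_\eta^2$, $\mathbb{E}[\|\boldsymbol\xi_k\|^2]\le\sigma_\xi^2$ for some $\sigma_\eta,\sigma_\xi>0$. Notation: $W_o$ is $W$ with all diagonal entries replaced by zeros; $\rho(\cdot)$ is the spectral radius; $\boldsymbol 1$ is the all-ones vector; $\rho_w=\rho(W-\frac{\boldsymbol{1}\boldsymbol{1}^T}{n})$, which is $<1$ under (W); for matrices, $\|\cdot\|_2$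 is the Euclidean norm of the vector of columnwise Euclidean norms; $d_I^2=\|I-\frac{\boldsymbol{1}\boldsymbol{1}^T}{n}\|_2^2$, $d_I\ge0$. Algorithm (with $\gamma_k=\beta_k=1$): from arbitrary initial states $\boldsymbol{s}_0,\boldsymbol{x}_0\in\mathbb{R}^{n\times r}$, $$\boldsymbol{s}_{k+1}=W\boldsymbol{s}_k+W_o\boldsymbol\eta_k+\nabla F(\boldsymbol{x}_k),\qquad \boldsymbol{x}_{k+1}=W\boldsymbol{x}_k+W_o\boldsymbol\xi_k-\alpha(\boldsymbol{s}_{k+1}-\boldsymbol{s}_k),$$ where $\nabla F(\boldsymbol{x})$ has $i$-th row $\nabla f_i(x_i)^T$, with $x_i^T$ the $i$-th row of $\boldsymbol{x}$. Definition of $\theta$: $\theta:=2n\theta_1+2\theta_2$, where $\theta_1,\theta_2$ are the first and second elements of $(I-A)^{-1}B$ with $$A=\begin{bmatrix}1-\alpha\mu&\frac{2\alpha L^2}{\mu n}&0\\[1mm]0&\frac{1+\rho_w^2}2&\frac{2\alpha^2}{1-\rho_w^2}\\[1mm]\frac{32n\alpha^2L^4d_I^2}{1-\rho_w^2}&\frac{64d_I^2L^2}{1-\rho_w^2}&\frac{1+\rho_w^2}2+\frac{16\alpha^2L^2d_I^2}{1-\rho_w^2}\end{bmatrix},\qquad B=\begin{bmatrix}\alpha^2\sigma_\eta^2+\sigma_\xi^2\\[1mm]nd_I^2\sigma_\xi^2\\[1mm]\frac{24nd_I^2}{1-\rho_w^2}\sigma_\eta^2+\frac{4nL^2d_I^2}{1-\rho_w^2}\sigma_\xi^2\end{bmatrix}\rho(W_o)^2.$$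 The quantity $\theta$ is an upper bound on $\limsup_{k\to\infty}\mathbb{E}[\|\boldsymbol{x}_k-\boldsymbol{1}x^\ast\|_2^2]$ ($x^\ast$ read as a row vector). The partial derivatives are those of this expression for $\theta$, viewed as a function of $\rho_w$ and $\rho(W_o)$ with the other parameters fixed.
   Formalization: The inequality ∂θ/∂ρ_w > 0 is stated only for ρ_w ≠ 0, since θ depends on ρ_w through ρ_w² and the derivative is 0 at ρ_w = 0 (e.g. W = 11^T/n); strict increase of θ to the right of ρ_w is stated in all cases. *)

(* Defs.v *)
From HB Require Import structures.
From mathcomp Require Import all_boot all_order all_algebra.
From mathcomp Require Import complex.
From mathcomp Require Import all_classical all_reals all_analysis.

Set Implicit Arguments.
Unset Strict Implicit.
Unset Printing Implicit Defensive.

Import Order.TTheory GRing.Theory Num.Theory.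
Import numFieldNormedType.Exports.

Local Open Scope classical_set_scope.
Local Open Scope ring_scope.

(** Points of R^r are row vectors, so that the state of agent i is the i-th row
    of an n x r matrix. *)
Section Euclidean.
Context {R : realType}.

Definition dotv (r : nat) (u v : 'rV[R]_r) : R := \sum_(j < r) u 0 j * v 0 j.

(** The library norm on matrices is the sup norm, hence a separate definition. *)
Definition norm2v (r : nat) (u : 'rV[R]_r) : R := Num.sqrt (dotv u u).

(** Euclidean norm of the vector of Euclidean norms of the columns. *)
Definition norm2m (m p : nat) (A : 'M[R]_(m, p)) : R :=
  norm2v (\row_(j < p) norm2v (col j A)^T).

Definition gradient (r : nat) (f : 'rV[R]_r -> R) (x : 'rV[R]_r) : 'rV[R]_r :=
  \row_(j < r) ('D_(delta_mx 0 j) f x).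

Definition strongly_monotone_gradient (r : nat) (mu : R)
    (f : 'rV[R]_r -> R) : Prop :=
  forall x x', mu * norm2v (x - x') ^+ 2
               <= dotv (gradient f x - gradient f x') (x - x').

Definition lipschitz_gradient (r : nat) (L : R) (f : 'rV[R]_r -> R) : Prop :=
  forall x x', norm2v (gradient f x - gradient f x') <= L * norm2v (x - x').

Record objective_assumption (n r : nat) (mu L : R)
    (f : 'I_n -> 'rV[R]_r -> R) : Prop := ObjectiveAssumption {
  objective_mu_gt0 : 0 < mu ;
  objective_differentiable : forall i x, differentiable (f i) x ;
  objective_strongly_convex : forall i, strongly_monotone_gradient mu (f i) ;
  objective_lipschitz : forall i, lipschitz_gradient L (f i)
}.

End Euclidean.

Section Weights.
Context {R : realType}.

Record weight_assumption (n : nat) (W : 'M[R]_n) : Prop := WeightAssumption {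
  weight_ge0 : forall i j, 0 <= W i j ;
  weight_row_sum : forall i, \sum_(j < n) W i j = 1 ;
  weight_col_sum : forall j, \sum_(i < n) W i j = 1 ;
  weight_sym : forall i j, W i j = W j i ;
  weight_diag_gt0 : forall i, 0 < W i i ;
  weight_connected : forall i j, connect (fun k l : 'I_n => 0 < W k l) i j
}.

Definition offdiag (n : nat) (W : 'M[R]_n) : 'M[R]_n :=
  \matrix_(i, j) (if i == j then 0 else W i j).

(** [avg_mx n] is 1 1^T / n. *)
Definition avg_mx (n : nat) : 'M[R]_n := const_mx (n%:R^-1).

(** Largest modulus of a complex eigenvalue. *)
Definition spectral_radius (n : nat) (A : 'M[R]_n) : R :=
  sup [set ComplexField.Normc.normc z
      | z in [set z : R[i] | eigenvalue (map_mx (real_complex R) A) z]].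

Definition rho_w (n : nat) (W : 'M[R]_n) : R := spectral_radius (W - avg_mx n).

Definition rho_o (n : nat) (W : 'M[R]_n) : R := spectral_radius (offdiag W).

Definition d_I (n : nat) : R := norm2m (1%:M - avg_mx n).

End Weights.

Section Noise.
Context {R : realType} {d : measure_display} {T : measurableType d}.
Variable P : probability T R.

Definition mutually_independent (I : eqType) (X : I -> {RV P >-> R}) : Prop :=
  forall (J : seq I) (B : I -> set R), uniq J -> (forall i, measurable (B i)) ->
    P [set w | forall i, i \in J -> B i (X i w)]
    = (\prod_(i <- J) P (X i @^-1` B i))%E.

Definition noise_mx (n r : nat) (eta : nat -> 'I_n -> 'I_r -> {RV P >-> R})
    (k : nat) (w : T) : 'M[R]_(n, r) := \matrix_(i, j) eta k i j w.

Record noise_assumption (n r : nat) (sigma : R)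
    (eta : nat -> 'I_n -> 'I_r -> {RV P >-> R}) : Prop := NoiseAssumption {
  noise_sigma_gt0 : 0 < sigma ;
  noise_independent :
    mutually_independent (fun kij : nat * 'I_n * 'I_r =>
                            eta kij.1.1 kij.1.2 kij.2) ;
  noise_mean0 : forall k i j, ('E_P[eta k i j] = 0)%E ;
  noise_second_moment : forall k,
    ('E_P[fun w => (norm2m (noise_mx eta k w) ^+ 2)%R] <= (sigma ^+ 2)%:E)%E
}.

End Noise.

Section Algorithm.
Context {R : realType}.

Definition stacked_gradient (n r : nat) (f : 'I_n -> 'rV[R]_r -> R)
    (x : 'M[R]_(n, r)) : 'M[R]_(n, r) :=
  \matrix_(i, j) gradient (f i) (row i x) 0 j.

Record algorithm_run (n r : nat) (W : 'M[R]_n) (f : 'I_n -> 'rV[R]_r -> R)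
    (alpha : R) (T : Type) (eta xi : nat -> T -> 'M[R]_(n, r))
    (s0 x0 : 'M[R]_(n, r)) (s x : nat -> T -> 'M[R]_(n, r)) : Prop :=
  AlgorithmRun {
  run_s0 : forall w, s 0%N w = s0 ;
  run_x0 : forall w, x 0%N w = x0 ;
  run_s : forall k w, s k.+1 w =
    W *m s k w + offdiag W *m eta k w + stacked_gradient f (x k w) ;
  run_x : forall k w, x k.+1 w =
    W *m x k w + offdiag W *m xi k w - alpha *: (s k.+1 w - s k w)
}.

End Algorithm.

(** In this section [n], [mu], [L], [alpha], [sigma_eta], [sigma_xi], [dI] are
    the parameters held fixed; [rw] and [ro] are free real variables standing
    for the two spectral radii. *)
Section OptimizationError.
Context {R : realType}.
Variables (n : nat) (mu L alpha sigma_eta sigma_xi dI : R).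

Definition theta_A (rw : R) : 'M[R]_3 :=
  \matrix_(i, j) nth 0 (nth [::]
    [:: [:: 1 - alpha * mu; 2 * alpha * L ^+ 2 / (mu * n%:R); 0];
        [:: 0; (1 + rw ^+ 2) / 2; 2 * alpha ^+ 2 / (1 - rw ^+ 2)];
        [:: 32 * n%:R * alpha ^+ 2 * L ^+ 4 * dI ^+ 2 / (1 - rw ^+ 2);
            64 * dI ^+ 2 * L ^+ 2 / (1 - rw ^+ 2);
            (1 + rw ^+ 2) / 2
            + 16 * alpha ^+ 2 * L ^+ 2 * dI ^+ 2 / (1 - rw ^+ 2)]] i) j.

Definition theta_B (rw ro : R) : 'cV[R]_3 :=
  ro ^+ 2 *: \col_i nth 0
    [:: alpha ^+ 2 * sigma_eta ^+ 2 + sigma_xi ^+ 2;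
        n%:R * dI ^+ 2 * sigma_xi ^+ 2;
        24 * n%:R * dI ^+ 2 / (1 - rw ^+ 2) * sigma_eta ^+ 2
        + 4 * n%:R * L ^+ 2 * dI ^+ 2 / (1 - rw ^+ 2) * sigma_xi ^+ 2] i.

Definition theta_vec (rw ro : R) : 'cV[R]_3 :=
  invmx (1%:M - theta_A rw) *m theta_B rw ro.

Definition theta (rw ro : R) : R :=
  2 * n%:R * theta_vec rw ro 0 0 + 2 * theta_vec rw ro 1 0.

Definition step_d1 (rw : R) : R :=
  128 * L ^+ 6 * dI ^+ 2 / (mu * (1 - rw ^+ 2) ^+ 2).

Definition step_d2 (rw : R) : R :=
  8 * mu * L ^+ 2 * dI ^+ 2
  + 128 * mu * dI ^+ 2 * L ^+ 2 / (1 - rw ^+ 2) ^+ 2.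

Definition step_d3 (rw : R) : R := mu * (1 - rw ^+ 2) ^+ 2 / 4.

Definition step_bound (rw : R) : R :=
  Num.min (1 / (mu + L))
    (Num.min ((1 - rw ^+ 2) / (8 * dI * L))
      (Num.sqrt (2 * step_d3 rw /
        (step_d2 rw
         + Num.sqrt (step_d2 rw ^+ 2 + 4 * step_d1 rw * step_d3 rw))))).

End OptimizationError.

(* Main.v *)
Require Import Defs.
From HB Require Import structures.
From mathcomp Require Import all_boot all_order all_algebra.
From mathcomp Require Import complex.
From mathcomp Require Import all_classical all_reals all_analysis.
From mathcomp Require Import ring lra.

Set Implicit Arguments.
Unset Strict Implicit.
Unset Printing Implicit Defensive.

Import Order.TTheory GRing.Theory Num.Theory.
Import numFieldNormedType.Exports.

Local Open Scope classical_set_scope.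
Local Open Scope ring_scope.

(** Write u = 1 - rw ^ 2. The matrix I - A is

      [ a  -b   0 ]
      [ 0   g  -h ]
      [ -k -l   m ]

    so the first component of its solution is an affine function, with
    positive coefficients that do not involve rw, of the second one; and the
    second one can be computed by Cramer's rule. Clearing the powers of u gives
    ([theta_formula])

      theta = ro ^ 2 * (K + kappa * num u / den u),   K, kappa > 0,
      num u = p + c * u * y,   den u = e * y * (y + q) - t,   y = u ^ 2 / 2 - q,

    where p, c, e, q, t > 0 depend on neither spectral radius, and den u is a
    positive multiple of det (I - A). Monotonicity in ro is then clear as soon
    as num and den are positive.

    For the monotonicity in rw, the point is that y + q = u ^ 2 / 2, whence

      num u / den u = p / den u + c / (e * u / 2 - t / (u * y)),

    and both denominators increase with u as long as y > 0. So the quotient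
    decreases in u, i.e. increases in rw. This gives the strict inequality to
    the right of rho_w ([num_div_den_decreasing]), also at rho_w = 0 where the
    derivative vanishes because theta is even in rw; and the derivative of the
    quotient with respect to rw is 2 * rw * slope u / den u ^ 2, where slope is
    a sum of positive terms ([is_derive_num_div_den]).

    The step-size condition is what makes the two signs right: its second
    term gives y > 0 and its third one, a bound by the positive root of a
    quadratic polynomial in alpha ^ 2, gives den u > 0 ([step_bound_gap_den]).
    It also forces d_I > 0, hence n > 1.

    The weight matrix enters through 0 <= rho_w < 1 ([rho_w_lt1]) and
    rho_o > 0 ([rho_o_gt0]), the latter being needed for strictness. The first
    follows from the identity

      \sum_(i, j) W i j * |v j - z * v i| ^ 2 = (1 - |z| ^ 2) * |v| ^ 2

    for an eigenvector v of W, together with connectedness and the positivity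
    of the diagonal of W; the second from the spectral theorem, the
    off-diagonal part of W being symmetric and nonzero. *)

(** * Connected graphs and weighted means *)

Lemma connect_const (I : finType) (A : Type) (e : rel I) (f : I -> A) :
  (forall i j, e i j -> f i = f j) -> forall i j, connect e i j -> f i = f j.
Proof.
move=> fe i j /connectP[p]; elim: p i => [|k p IHp] i /= => [_ -> //|].
by case/andP=> /fe -> /IHp.
Qed.

(** The variance identity E|X - EX|^2 = E|X|^2 - |EX|^2 for a complex random
    variable taking the value v j with probability w j. *)
Lemma weighted_dispersion (C : numClosedFieldType) (n : nat) (w v : 'I_n -> C)
    (m := \sum_j w j * v j) :
  (forall j, 0 <= w j) -> \sum_j w j = 1 ->
  \sum_j w j * `|v j - m| ^+ 2 = \sum_j w j * `|v j| ^+ 2 - `|m| ^+ 2.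
Proof.
move=> w_ge0 w1; have w_conj j : (w j)^* = w j by apply/geC0_conj.
have mC : \sum_j w j * (v j)^* = m^*.
  by rewrite rmorph_sum; apply: eq_bigr => j _; rewrite rmorphM /= w_conj.
transitivity (\sum_j (w j * `|v j| ^+ 2 - w j * v j * m^*
                      - w j * (v j)^* * m + w j * `|m| ^+ 2)).
  apply: eq_bigr => j _; rewrite !normCK rmorphB /=; ring.
rewrite big_split !sumrB /= -!mulr_suml mC w1 normCK -/m; ring.
Qed.

(** * Spectral radius of a real matrix *)

Section SpectralRadius.
Context {R : realType}.
Implicit Types n : nat.

Let cplx n (A : 'M[R]_n) := map_mx (real_complex R) A.

Lemma eigenvalue_seq (F : closedFieldType) n (A : 'M[F]_n) :
  {rs : seq F | forall z, eigenvalue A z = (z \in rs)}.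
Proof.
have [rs Ars] := closed_field_poly_normal (char_poly A); exists rs => z.
rewrite eigenvalue_root_char Ars (monicP (char_poly_monic A)) scale1r.
exact: root_prod_XsubC.
Qed.

Lemma normc_le_spectral_radius n (A : 'M[R]_n) (z : R[i]) :
  eigenvalue (cplx A) z -> ComplexField.Normc.normc z <= spectral_radius A.
Proof.
move=> Az; apply: ub_le_sup; last by exists z.
have [rs rsP] := eigenvalue_seq (cplx A).
exists (\big[Num.max/0]_(z <- rs) ComplexField.Normc.normc z) => _ [y Ay <-].
by apply: le_bigmax_seq => //; rewrite -rsP.
Qed.

(** Strictness survives the supremum because a matrix has finitely many
    eigenvalues; the positivity of c covers the matrix of size 0, whose spectrum
    is empty. *)
Lemma spectral_radius_lt n (A : 'M[R]_n) c : 0 < c ->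
  (forall z, eigenvalue (cplx A) z -> ComplexField.Normc.normc z < c) ->
  spectral_radius A < c.
Proof.
move=> c_gt0 Ac; have [rs rsP] := eigenvalue_seq (cplx A).
rewrite /spectral_radius; set E := image _ _.
have [->|E_neq0] := eqVneq E set0; first by rewrite sup0.
apply: (@le_lt_trans _ _
  (\big[Num.max/0]_(z <- rs) ComplexField.Normc.normc z)).
  apply: ge_sup; first exact/set0P.
  by move=> _ [y Ay <-]; apply: le_bigmax_seq => //; rewrite -rsP.
rewrite big_seq; elim/big_ind: _ => // [x y|z]; first by rewrite gt_max => -> ->.
by rewrite -rsP => /Ac.
Qed.

Lemma spectral_radius_ge0 n (A : 'M[R]_n) : 0 <= spectral_radius A.
Proof.
rewrite /spectral_radius; set E := image _ _.
have [->|/set0P[_ [z Az _]]] := eqVneq E set0; first by rewrite sup0.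
apply: le_trans (normc_le_spectral_radius Az).
by case: z {Az} => a b; exact: sqrtr_ge0.
Qed.

(** A real symmetric matrix is diagonalizable, so it vanishes if all its
    eigenvalues do. *)
Lemma spectral_radius_gt0 n (A : 'M[R]_n) :
  (forall i j, A i j = A j i) -> A != 0 -> 0 < spectral_radius A.
Proof.
move=> Asym A_neq0.
have Anormal : cplx A \is normalmx.
  apply: symmetric_normalmx.
    apply/is_hermitianmxP; rewrite expr0 scale1r map_mx_id //.
    by apply/matrixP => i j; rewrite !mxE Asym.
  by apply/mxOverP => i j; rewrite mxE; apply/complex_realP; exists (A i j).
have /orthomx_spectralP := Anormal.
set P := spectralmx _; set D := spectral_diag _ => AE.
have Punit : P \in unitmx by exact: spectral_unit.
have [k Dk] : exists k, D 0 k != 0.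
  apply/existsP; apply: contraNT A_neq0; rewrite negb_exists => /forallP D0.
  have D_eq0 : D = 0.
    by apply/rowP => k; rewrite mxE; apply/eqP; rewrite -[_ == _]negbK D0.
  rewrite -(map_mx_eq0 (real_complex R)) -/(cplx A) AE D_eq0.
  rewrite (_ : diag_mx 0 = 0) ?mulmx0 ?mul0mx //.
  by apply/matrixP => i j; rewrite !mxE mul0rn.
have eigDk : eigenvalue (cplx A) (D 0 k).
  apply/eigenvalueP; exists (row k P).
    rewrite -row_mul AE !mulmxA mulmxV // mul1mx row_mul row_diag_mx.
    by rewrite -scalemxAl -rowE.
  apply/eqP => Pk0; have := congr1 (row k) (mulmxV Punit).
  rewrite row_mul Pk0 mul0mx => /rowP/(_ k)/eqP.
  by rewrite !mxE eqxx eq_sym oner_eq0.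
apply: lt_le_trans (normc_le_spectral_radius eigDk).
have : 0 < `|D 0 k| by rewrite normr_gt0.
by rewrite normc_def ltcR; case: (D 0 k).
Qed.

End SpectralRadius.

(** * Spectral radii of a weight matrix *)

Lemma d_I1 (R : realType) : d_I 1 = 0 :> R.
Proof.
rewrite /d_I (_ : 1%:M - avg_mx 1 = 0); last first.
  by apply/matrixP => i j; rewrite !mxE !ord1 invr1 subrr.
rewrite /norm2m /norm2v /dotv !big_ord1 !mxE big_ord1 !mxE mul0r sqrtr0 mul0r.
exact: sqrtr0.
Qed.

Section WeightSpectrum.
Context {R : realType} (n : nat) (W : 'M[R]_n) (hW : weight_assumption W).

(** An eigenvector v for z != 0 has zero sum, so it is an eigenvector of W
    itself and z * v i is the W i-weighted mean of v. Summing the variance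
    identity over i gives a nonnegative energy equal to
    (1 - |z| ^ 2) * |v| ^ 2. If |z| >= 1, the energy vanishes, so that
    v j = z * v i on every edge; the loop at i gives v i = z * v i, hence v is
    constant on the connected graph, and its zero sum makes it vanish. *)
Lemma eigenvalue_centered_weight_lt1 (z : R[i]) :
  eigenvalue (map_mx (real_complex R) (W - avg_mx n)) z ->
  ComplexField.Normc.normc z < 1.
Proof.
case/eigenvalueP => v vW v_neq0.
have n_gt0 : (0 < n)%N by case: n v v_neq0 {vW} => // v; rewrite thinmx0 eqxx.
pose w i j : R[i] := (W i j)%:C%C.
have w_ge0 i j : 0 <= w i j by rewrite lecR weight_ge0.
have w_row i : \sum_j w i j = 1 by rewrite -rmorph_sum weight_row_sum.
have n_neq0 : (n%:R : R[i]) != 0 by rewrite pnatr_eq0 -lt0n.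
have vWE j : \sum_k v 0 k * (w j k - n%:R^-1) = z * v 0 j.
  have /rowP/(_ j) := vW; rewrite !mxE => <-; apply: eq_bigr => k _.
  by rewrite !mxE rmorphB /= fmorphV rmorph_nat /w (weight_sym hW).
have sum_v : z * \sum_j v 0 j = 0.
  rewrite mulr_sumr; under eq_bigr do rewrite -vWE.
  rewrite exchange_big /= big1 // => k _; rewrite -mulr_sumr sumrB.
  under eq_bigr do rewrite /w (weight_sym hW).
  by rewrite w_row sumr_const card_ord -[_^-1 *+ _]mulr_natr mulVf // subrr mulr0.
suff z_lt1 : `|z| < 1.
  by move: z_lt1; rewrite normc_def -(rmorph1 (real_complex R)) ltcR; case: (z).
rewrite real_ltNge ?normr_real ?real1 //; apply/negP => z_ge1.
have z_neq0 : z != 0 by rewrite -normr_gt0; exact: lt_le_trans z_ge1.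
have v_sum0 : \sum_j v 0 j = 0.
  by apply/eqP; move/eqP: sum_v; rewrite mulf_eq0 (negPf z_neq0).
have mean i : \sum_j w i j * v 0 j = z * v 0 i.
  rewrite -vWE; under [RHS]eq_bigr do rewrite mulrBr.
  rewrite sumrB -mulr_suml v_sum0 mul0r subr0.
  by apply: eq_bigr => j _; rewrite mulrC.
have energy : \sum_i \sum_j w i j * `|v 0 j - z * v 0 i| ^+ 2
              = (1 - `|z| ^+ 2) * \sum_i `|v 0 i| ^+ 2.
  under eq_bigr do rewrite -mean weighted_dispersion // mean normrM exprMn.
  rewrite sumrB exchange_big /= mulrBl mul1r mulr_sumr; congr (_ - _).
  apply: eq_bigr => j _; rewrite -mulr_suml.
  by under eq_bigr do rewrite /w (weight_sym hW); rewrite w_row mul1r.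
have term_ge0 i j : 0 <= w i j * `|v 0 j - z * v 0 i| ^+ 2.
  by rewrite mulr_ge0 // exprn_ge0.
have row_ge0 i : 0 <= \sum_j w i j * `|v 0 j - z * v 0 i| ^+ 2 by exact: sumr_ge0.
have energy0 : \sum_i \sum_j w i j * `|v 0 j - z * v 0 i| ^+ 2 = 0.
  apply/eqP; rewrite eq_le sumr_ge0 // andbT energy mulr_le0_ge0 //.
    by rewrite subr_le0 exprn_ege1.
  by apply: sumr_ge0 => i _; rewrite exprn_ge0.
have edge i j : 0 < W i j -> v 0 j = z * v 0 i.
  move=> Wij; have /(_ i isT) := psumr_eq0P (fun i _ => row_ge0 i) energy0.
  move=> /(psumr_eq0P (fun j _ => term_ge0 i j))/(_ j isT)/eqP.
  rewrite mulf_eq0 expf_eq0 normr_eq0 subr_eq0 /= /w fmorph_eq0.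
  by rewrite gt_eqF // => /eqP.
have v_const i j : v 0 i = v 0 j.
  apply: connect_const (weight_connected hW i j) => k l /edge ->.
  exact/edge/weight_diag_gt0.
case/eqP: v_neq0; apply/rowP => i; rewrite mxE; apply/eqP.
move/eqP: v_sum0; under eq_bigr do rewrite (v_const _ i).
by rewrite sumr_const card_ord -mulr_natr mulf_eq0 (negPf n_neq0) orbF.
Qed.

Lemma rho_w_lt1 : rho_w W < 1.
Proof. exact: spectral_radius_lt eigenvalue_centered_weight_lt1. Qed.

(** If the off-diagonal part vanished, no edge would join distinct vertices and
    the graph could not be connected. *)
Lemma rho_o_gt0 : (1 < n)%N -> 0 < rho_o W.
Proof.
move=> n_gt1; apply: spectral_radius_gt0.
  by move=> i j; rewrite !mxE eq_sym (weight_sym hW).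
apply/eqP => W0; pose i0 := Ordinal (ltnW n_gt1); pose i1 := Ordinal n_gt1.
suff : i0 = i1 by move/(congr1 val).
apply: (connect_const (f := id) _ (weight_connected hW i0 i1)) => i j Wij.
apply/eqP/negP => /negP ij; have /matrixP/(_ i j) := W0; rewrite !mxE (negPf ij).
by apply/eqP; rewrite gt_eqF.
Qed.

End WeightSpectrum.

(** * The rational function governing the dependence on rho_w *)

Section RationalFunction.
Context {R : realType}.

Lemma horner_near_gt0 (f : {poly R}) (x : R) :
  0 < f.[x] -> \forall y \near x, 0 < f.[y].
Proof. exact: (cvgr_gt f.[x] (@continuous_horner _ f x)). Qed.

Lemma is_derive_horner_div (f g : {poly R}) (x : R) : g.[x] != 0 ->
  is_derive x 1 (fun y => f.[y] / g.[y])
    ((f^`().[x] * g.[x] - f.[x] * g^`().[x]) / g.[x] ^+ 2).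
Proof.
move=> gx.
have dV : is_derive x 1 (fun y => g.[y]^-1) (- g.[x] ^- 2 *: g^`().[x]).
  apply: DeriveDef; first exact/derivableV/derivable_horner.
  by rewrite deriveV // derive_val.
apply: is_derive_eq; rewrite /GRing.scale /=; field.
exact: gx.
Qed.

Variables (p c e q t : R).

(** With u = 1 - rw ^ 2 and the coefficients chosen for [theta_formula],
    den u = u ^ 2 * det (I - A), num u is u ^ 2 times the second entry of
    adj (I - A) B for ro = 1, and gap u is u times the last diagonal entry of
    I - A. *)
Definition gap (u : R) := u ^+ 2 / 2 - q.
Definition num (u : R) := p + c * (u * gap u).
Definition den (u : R) := e * (gap u * (gap u + q)) - t.

(** The numerator of minus the derivative of num / den in u, rearranged with the
    help of gap u + q = u ^ 2 / 2 so that all its terms are positive. *)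
Definition slope (u : R) :=
  p * e * u * (2 * gap u + q) + c * t * (gap u + u ^+ 2)
  + c * e * gap u ^+ 2 * (gap u + q).

(** The same functions as polynomials in rw, where u = 1 - rw ^ 2. *)
Definition gap_poly : {poly R} := 2^-1 *: (1 - 'X^2) ^+ 2 - q%:P.
Definition num_poly : {poly R} := p%:P + c *: ((1 - 'X^2) * gap_poly).
Definition den_poly : {poly R} := e *: (gap_poly * (gap_poly + q%:P)) - t%:P.

Lemma gap_polyE x : gap_poly.[x] = gap (1 - x ^+ 2).
Proof. by rewrite /gap_poly /gap !hornerE /=; field. Qed.

Lemma num_polyE x : num_poly.[x] = num (1 - x ^+ 2).
Proof.
rewrite /num_poly /num mulrA; have := gap_polyE x.
by move: gap_poly => g gE; rewrite !hornerE /= gE.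
Qed.

Lemma den_polyE x : den_poly.[x] = den (1 - x ^+ 2).
Proof.
rewrite /den_poly /den mulrA; have := gap_polyE x.
by move: gap_poly => g gE; rewrite !hornerE /= gE.
Qed.

Lemma is_derive_num_div_den (x : R) (u := 1 - x ^+ 2) : den u != 0 ->
  is_derive x 1 (fun y => num (1 - y ^+ 2) / den (1 - y ^+ 2))
    (2 * x * slope u / den u ^+ 2).
Proof.
move=> den_neq0.
have -> : (fun y => num (1 - y ^+ 2) / den (1 - y ^+ 2))
          = (fun y => num_poly.[y] / den_poly.[y]).
  by apply/funext => y; rewrite num_polyE den_polyE.
have denx : den_poly.[x] != 0 by rewrite den_polyE.
apply: is_derive_eq (is_derive_horner_div num_poly denx) _.
rewrite num_polyE den_polyE -/u; congr (_ / _).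
rewrite /slope /num_poly /den_poly /gap_poly !poly.derivE !hornerE /=.
by rewrite /num /den /gap /u; field.
Qed.

Hypotheses (p_gt0 : 0 < p) (c_gt0 : 0 < c) (e_gt0 : 0 < e) (q_gt0 : 0 < q)
  (t_gt0 : 0 < t).

Lemma slope_gt0 (u : R) : 0 < u -> 0 < gap u -> 0 < slope u.
Proof.
rewrite /slope; move: (gap u) => y u_gt0 y_gt0.
have yq_gt0 : 0 < y + q by exact: addr_gt0.
have y2q_gt0 : 0 < 2 * y + q by rewrite addr_gt0 ?mulr_gt0.
have yu_gt0 : 0 < y + u ^+ 2 by rewrite addr_gt0 ?exprn_gt0.
by apply: addr_gt0; first apply: addr_gt0; rewrite ?mulr_gt0 ?exprn_gt0.
Qed.

(** The sign of num u * den v - num v * den u is read off a rearrangement into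
    positive terms, the last of which comes from y + q = u ^ 2 / 2. *)
Lemma num_div_den_decreasing (u v : R) :
  0 < u -> u < v -> 0 < gap u -> 0 < den u -> num v / den v < num u / den u.
Proof.
move=> u_gt0 uv yu_gt0 den_gt0; have v_gt0 : 0 < v by exact: lt_trans uv.
have y_lt : gap u < gap v.
  rewrite /gap ltrD2r ltr_pM2r ?invr_gt0 ?ltr0n //.
  by rewrite ltr_pXn2r ?nnegrE ?ltW.
have yv_gt0 := lt_trans yu_gt0 y_lt.
have uy_lt : u * gap u < v * gap v by apply: ltr_pM => //; exact: ltW.
have den_lt : den u < den v.
  rewrite /den ltrD2r ltr_pM2l //.
  move: (gap u) (gap v) yu_gt0 y_lt => a b a_gt0 ab.
  by apply: ltr_pM; rewrite ?ltrD2r // ltW // addr_gt0.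
rewrite ltr_pdivrMr ?(lt_trans den_gt0) // mulrAC ltr_pdivlMr // -subr_gt0.
have -> : num u * den v - num v * den u =
  p * e * (gap v - gap u) * (gap v + gap u + q)
  + c * t * (v * gap v - u * gap u)
  + c * e * (u * gap u) * (v * gap v) * (v - u) / 2.
  by rewrite /num /den /gap; field.
move: (gap u) (gap v) yu_gt0 yv_gt0 y_lt uy_lt => a b a_gt0 b_gt0 ab uab.
have s_gt0 : 0 < b + a + q by rewrite addr_gt0 // addr_gt0.
by apply: addr_gt0; first apply: addr_gt0; rewrite ?mulr_gt0 ?subr_gt0 ?invr_gt0.
Qed.

End RationalFunction.

(** * Solving the linear system defining theta *)

Section SparseSystem.
Variable F : fieldType.

Definition mx33 (s : seq (seq F)) : 'M[F]_3 :=
  \matrix_(i, j) nth 0 (nth [::] s i) j.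

Lemma sparse_system_sol (a b g h k l m w0 w1 w2 : F)
    (Delta := a * (g * m - h * l) - b * h * k)
    (M := mx33 [:: [:: a; - b; 0]; [:: 0; g; - h]; [:: - k; - l; m]]) :
  a != 0 -> Delta != 0 ->
  let v := invmx M *m \col_i nth 0 [:: w0; w1; w2] i in
  v 1 0 = (h * k * w0 + a * m * w1 + a * h * w2) / Delta
  /\ v 0 0 = (w0 + b * v 1 0) / a.
Proof.
move=> a_neq0 Delta_neq0 v.
(* The adjugate of M; Delta is its determinant. *)
pose X := mx33 [:: [:: g * m - h * l; b * m; b * h];
                   [:: h * k; a * m; a * h];
                   [:: g * k; a * l + b * k; a * g]].
have MX : M *m (Delta^-1 *: X) = 1%:M.
  rewrite -scalemxAr; apply/matrixP => i j.
  rewrite !mxE !big_ord_recr big_ord0 /= !mxE.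
  apply: (mulfI Delta_neq0); rewrite mulVKf //.
  by case: i j => [[|[|[|//]]] ?] [[|[|[|//]]] ?] /=;
    rewrite ?(mulr1n, mulr0n) /Delta; ring.
have -> : v = Delta^-1 *: X *m \col_i nth 0 [:: w0; w1; w2] i.
  have [Munit _] := mulmx1_unit MX.
  by rewrite /v -[in LHS](mul1mx (\col__ _)) -MX -mulmxA mulKmx.
rewrite -scalemxAl !mxE !big_ord_recr !big_ord0 /= !mxE /=.
by split; rewrite /Delta; field; rewrite -?/Delta ?a_neq0.
Qed.

End SparseSystem.

Section ThetaFormula.
Context {R : realType}.
Variables (n : nat) (mu L alpha sigma_eta sigma_xi dI : R).

(** The entries of B / ro ^ 2 are [b_optimality], [b_consensus] and
    [b_tracking] / (1 - rw ^ 2): they feed the bounds on the optimality error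
    of the mean state, the consensus error and the gradient-tracking error. *)
Definition b_optimality : R := alpha ^+ 2 * sigma_eta ^+ 2 + sigma_xi ^+ 2.
Definition b_consensus : R := n%:R * dI ^+ 2 * sigma_xi ^+ 2.
Definition b_tracking : R :=
  24 * n%:R * dI ^+ 2 * sigma_eta ^+ 2
  + 4 * n%:R * L ^+ 2 * dI ^+ 2 * sigma_xi ^+ 2.

Definition coef_q : R := 16 * alpha ^+ 2 * L ^+ 2 * dI ^+ 2.
Definition coef_e : R := alpha * mu.
Definition coef_c : R := coef_e * b_consensus.
Definition coef_p : R :=
  64 * n%:R * alpha ^+ 4 * L ^+ 4 * dI ^+ 2 * b_optimality
  + 2 * alpha ^+ 3 * mu * b_tracking.
Definition coef_t : R :=
  8 * coef_q * coef_e + 128 * alpha ^+ 5 * L ^+ 6 * dI ^+ 2 / mu.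

Let q := coef_q.
Let e := coef_e.
Let c := coef_c.
Let p := coef_p.
Let t := coef_t.

Lemma theta_formula (rw ro : R) (u := 1 - rw ^+ 2) :
  (0 < n)%N -> mu != 0 -> alpha != 0 -> u != 0 -> den e q t u != 0 ->
  theta n mu L alpha sigma_eta sigma_xi dI rw ro
  = ro ^+ 2 * (2 * n%:R * b_optimality / (alpha * mu)
               + (4 * L ^+ 2 / mu ^+ 2 + 2) * (num p c q u / den e q t u)).
Proof.
move=> n_gt0 mu_neq0 alpha_neq0 u_neq0 den_neq0.
have n_neq0 : n%:R != 0 :> R by rewrite pnatr_eq0 -lt0n.
pose b := 2 * alpha * L ^+ 2 / (mu * n%:R).
pose h := 2 * alpha ^+ 2 / u.
pose k := 32 * n%:R * alpha ^+ 2 * L ^+ 4 * dI ^+ 2 / u.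
pose l := 64 * dI ^+ 2 * L ^+ 2 / u.
pose m := u / 2 - 16 * alpha ^+ 2 * L ^+ 2 * dI ^+ 2 / u.
pose M := mx33 [:: [:: alpha * mu; - b; 0]; [:: 0; u / 2; - h]; [:: - k; - l; m]].
have IAE : 1%:M - theta_A n mu L alpha dI rw = M.
  apply/matrixP => i j; rewrite !mxE -/u /b /h /k /l /m.
  by case: i j => [[|[|[|//]]] ?] [[|[|[|//]]] ?] /=;
    rewrite /u; field; rewrite ?n_neq0 ?mu_neq0.
pose w := \col_(i < 3) nth 0 [:: b_optimality; b_consensus; b_tracking / u] i.
have BE : theta_B n L alpha sigma_eta sigma_xi dI rw ro = ro ^+ 2 *: w.
  congr (_ *: _); apply/matrixP => i j; rewrite !mxE -/u.
  by case: i => [[|[|[|//]]] ?] //=; rewrite /b_tracking; field.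
have DeltaE : alpha * mu * (u / 2 * m - h * l) - b * h * k = den e q t u / u ^+ 2.
  rewrite /b /h /k /l /m /den /gap /t /coef_t /e /coef_e /q /coef_q.
  by field; rewrite ?mu_neq0 ?u_neq0 ?n_neq0.
have [] := @sparse_system_sol R (alpha * mu) b (u / 2) h k l m
  b_optimality b_consensus (b_tracking / u).
- by rewrite mulf_neq0.
- by rewrite DeltaE mulf_neq0 // invr_neq0 // expf_neq0.
rewrite -/M -/w DeltaE => v1E v0E.
have -> : num p c q u / den e q t u = (invmx M *m w) 1 0.
  rewrite v1E /num /gap /h /k /m /p /coef_p /c /coef_c /coef_e /q /coef_q.
  by field; rewrite ?den_neq0 ?u_neq0.
have scaleE i : (ro ^+ 2 *: (invmx M *m w)) i 0 = ro ^+ 2 * (invmx M *m w) i 0.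
  by rewrite mxE.
rewrite /theta /theta_vec IAE BE -scalemxAr !scaleE v0E /b.
by field; rewrite ?mu_neq0 ?alpha_neq0 ?n_neq0.
Qed.

End ThetaFormula.

(** * What the step-size condition gives *)

Section StepSize.
Context {R : realType}.

(** The bound is the positive root of d1 * a ^ 2 + d2 * a - d3, written with the
    square root in the denominator. *)
Lemma lt_quadratic_root (d1 d2 d3 a : R) :
  0 <= d1 -> 0 < d2 -> 0 < d3 -> 0 <= a ->
  a < 2 * d3 / (d2 + Num.sqrt (d2 ^+ 2 + 4 * d1 * d3)) ->
  d1 * a ^+ 2 + d2 * a < d3.
Proof.
move=> d1_ge0 d2_gt0 d3_gt0 a_ge0.
have disc_ge0 : 0 <= d2 ^+ 2 + 4 * d1 * d3.
  by rewrite addr_ge0 ?sqr_ge0 // !mulr_ge0 // ltW.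
set S := Num.sqrt _; have S_ge0 : 0 <= S by exact: sqrtr_ge0.
have SE : S ^+ 2 = d2 ^+ 2 + 4 * d1 * d3 by rewrite sqr_sqrtr.
have d2S : d2 <= S.
  by rewrite -ler_sqr ?nnegrE ?(ltW d2_gt0) // SE lerDl !mulr_ge0 // ltW.
rewrite ltr_pdivlMr ?ltr_pwDl // => aS.
(* 4 d1 d3 = (S - d2) (S + d2), so after scaling by 4 d3 both factors
   a (d2 + S) can be bounded by 2 d3. *)
rewrite -(ltr_pM2l (x := 4 * d3)) ?mulr_gt0 //.
have -> : 4 * d3 * (d1 * a ^+ 2 + d2 * a) =
    (S - d2) * a * (a * (d2 + S)) + 4 * d3 * d2 * a.
  have -> : (S - d2) * a * (a * (d2 + S)) = (S ^+ 2 - d2 ^+ 2) * a ^+ 2 by ring.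
  by rewrite SE; ring.
apply: (@le_lt_trans _ _ (2 * d3 * (a * (d2 + S)))).
  have -> : 2 * d3 * (a * (d2 + S)) = (S - d2) * a * (2 * d3) + 4 * d3 * d2 * a.
    by ring.
  by rewrite lerD2r ler_wpM2l ?mulr_ge0 ?subr_ge0 // ltW.
have -> : 4 * d3 * d3 = 2 * d3 * (2 * d3) by ring.
by rewrite ltr_pM2l ?mulr_gt0.
Qed.

(** If dI were 0, the second term of the minimum would be a division by zero,
    hence 0, leaving no room for alpha. Otherwise that term says
    4 * q < u ^ 2, and the third one says d1 * alpha ^ 4 + d2 * alpha ^ 2 < d3,
    which is the positivity of den u up to the factor alpha * u ^ 2. *)
Lemma step_bound_gap_den (mu L dI alpha rw : R) (u := 1 - rw ^+ 2)
    (q := coef_q L alpha dI) :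
  0 < mu -> 0 < L -> 0 <= dI -> 0 < u -> 0 < alpha ->
  alpha < step_bound mu L dI rw ->
  [/\ 0 < dI, 0 < gap q u & 0 < den (coef_e mu alpha) q (coef_t mu L alpha dI) u].
Proof.
move=> mu_gt0 L_gt0 dI_ge0 u_gt0 alpha_gt0.
rewrite /step_bound !lt_min -/u => /and3P[_ alpha_lt_gap alpha_lt_sqrt].
have dI_gt0 : 0 < dI.
  rewrite lt_neqAle dI_ge0 andbT; apply: contraTneq alpha_lt_gap => <-.
  by rewrite mulr0 mul0r invr0 mulr0 -leNgt ltW.
have denom_gt0 : 0 < 8 * dI * L by rewrite !mulr_gt0.
split=> //.
  move: alpha_lt_gap; rewrite ltr_pdivlMr // => alpha_lt_gap.
  have : (alpha * (8 * dI * L)) ^+ 2 < u ^+ 2.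
    by rewrite ltr_pXn2r ?nnegrE ?mulr_ge0 ?ltW.
  have : 0 < (alpha * (8 * dI * L)) ^+ 2 by rewrite exprn_gt0 ?mulr_gt0.
  have -> : (alpha * (8 * dI * L)) ^+ 2 = 4 * q by rewrite /q /coef_q; ring.
  by rewrite /gap; lra.
have root := @lt_quadratic_root (step_d1 mu L dI rw) (step_d2 mu L dI rw)
  (step_d3 mu rw) (alpha ^+ 2).
have {root} : step_d1 mu L dI rw * (alpha ^+ 2) ^+ 2
              + step_d2 mu L dI rw * alpha ^+ 2 < step_d3 mu rw.
  apply: root; rewrite /step_d1 /step_d2 /step_d3 -/u.
  - by rewrite mulr_ge0 ?invr_ge0 ?mulr_ge0 ?exprn_ge0 ?ltW.
  - by rewrite addr_gt0 // ?mulr_gt0 ?invr_gt0 ?exprn_gt0.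
  - by rewrite !mulr_gt0 ?invr_gt0 ?exprn_gt0.
  - exact: sqr_ge0.
  - move: alpha_lt_sqrt; rewrite /step_d1 /step_d2 /step_d3 -/u.
    set X := _ / _ => alphaX.
    have X_gt0 : 0 < X by rewrite -sqrtr_gt0; exact: lt_trans alphaX.
    by rewrite -[X]sqr_sqrtr ?ltW // ltr_pXn2r ?nnegrE ?sqrtr_ge0 ?ltW.
rewrite -subr_gt0 => root.
have -> : den (coef_e mu alpha) q (coef_t mu L alpha dI) u = alpha * u ^+ 2 *
  (step_d3 mu rw - (step_d1 mu L dI rw * (alpha ^+ 2) ^+ 2
                    + step_d2 mu L dI rw * alpha ^+ 2)).
  rewrite /den /gap /coef_t /coef_e /q /coef_q /step_d1 /step_d2 /step_d3 -/u.
  by field; rewrite !gt_eqF.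
by rewrite !mulr_gt0 ?exprn_gt0.
Qed.

(** A nonpositive Lipschitz constant makes the gradient constant, which
    contradicts strong monotonicity between two distinct points; the latter
    exist because 0 < r. *)
Lemma lipschitz_constant_gt0 (r : nat) (mu L : R) (f : 'rV[R]_r -> R) :
  (0 < r)%N -> 0 < mu -> strongly_monotone_gradient mu f ->
  lipschitz_gradient L f -> 0 < L.
Proof.
move=> r_gt0 mu_gt0 /(_ (const_mx 1) 0) mono /(_ (const_mx 1) 0) lip.
rewrite ltNge; apply/negP => L_le0; move: mono lip; rewrite subr0.
set e := const_mx 1; set g := gradient f e - gradient f 0.
have dot_ge0 (v : 'rV[R]_r) : 0 <= dotv v v.
  by apply: sumr_ge0 => j _; rewrite -expr2 sqr_ge0.
have norm_e : 0 < norm2v e ^+ 2.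
  rewrite sqr_sqrtr // /dotv; under eq_bigr do rewrite !mxE mulr1.
  by rewrite sumr_const card_ord ltr0n.
move=> mono lip.
have /eqP : norm2v g = 0.
  apply/eqP; rewrite eq_le sqrtr_ge0 andbT (le_trans lip) //.
  by rewrite mulr_le0_ge0 // sqrtr_ge0.
rewrite sqrtr_eq0 => g_le0.
have g0 j : g 0 j = 0.
  apply/eqP; rewrite -sqrf_eq0 expr2; apply/eqP; move: j isT.
  apply: psumr_eq0P => [j _|]; first by rewrite -expr2 sqr_ge0.
  by apply/eqP; rewrite eq_le dot_ge0 andbT.
move: mono; rewrite /dotv big1 ?leNgt ?(mulr_gt0 mu_gt0 norm_e) // => j _.
by rewrite g0 mul0r.
Qed.

End StepSize.

(** * Monotonicity of theta *)

Section ThetaMonotone.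
Context {R : realType}.
Variables (n : nat) (mu L alpha sigma_eta sigma_xi dI rw0 ro0 : R).

Let th := theta n mu L alpha sigma_eta sigma_xi dI.
Let u0 := 1 - rw0 ^+ 2.
Let q := coef_q L alpha dI.
Let e := coef_e mu alpha.
Let c := coef_c n mu alpha sigma_xi dI.
Let p := coef_p n mu L alpha sigma_eta sigma_xi dI.
Let t := coef_t mu L alpha dI.

(** The closed form of theta is only available where I - A is invertible; the
    conditions on u0 are open, so it holds around rw0, which is enough for the
    derivative and for the comparison on the right of rw0. *)
Lemma theta_monotone : (0 < n)%N -> 0 < mu -> 0 < L -> 0 < alpha ->
  0 < sigma_eta -> 0 < sigma_xi -> 0 < dI -> 0 <= rw0 -> 0 < ro0 ->
  0 < u0 -> 0 < gap q u0 -> 0 < den e q t u0 ->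
  [/\ derivable (fun rw => th rw ro0) rw0 1,
      derivable (fun ro => th rw0 ro) ro0 1,
      rw0 != 0 -> 0 < derive1 (fun rw => th rw ro0) rw0,
      \forall rw \near rw0^'+, th rw0 ro0 < th rw ro0
    & 0 <= derive1 (fun ro => th rw0 ro) ro0].
Proof.
move=> n_gt0 mu_gt0 L_gt0 alpha_gt0 eta_gt0 xi_gt0 dI_gt0 rw_ge0 ro_gt0.
move=> u0_gt0 gap0 den0.
have n_gt0R : 0 < n%:R :> R by rewrite ltr0n.
pose bopt := b_optimality alpha sigma_eta sigma_xi.
have q_gt0 : 0 < q by rewrite !mulr_gt0 ?exprn_gt0.
have e_gt0 : 0 < e by rewrite mulr_gt0.
have c_gt0 : 0 < c by rewrite !mulr_gt0 ?exprn_gt0.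
have bopt_gt0 : 0 < bopt by rewrite addr_gt0 ?mulr_gt0 ?exprn_gt0.
have p_gt0 : 0 < p.
  by apply: addr_gt0;
    rewrite !mulr_gt0 ?exprn_gt0 ?addr_gt0 ?mulr_gt0 ?exprn_gt0.
have t_gt0 : 0 < t.
  by apply: addr_gt0; rewrite !mulr_gt0 ?invr_gt0 ?exprn_gt0.
pose K : R := 2 * n%:R * bopt / (alpha * mu).
pose kappa : R := 4 * L ^+ 2 / mu ^+ 2 + 2.
pose ratio (rw : R) := num p c q (1 - rw ^+ 2) / den e q t (1 - rw ^+ 2).
have kappa_gt0 : 0 < kappa by rewrite addr_gt0 ?mulr_gt0 ?invr_gt0 ?exprn_gt0.
have K_gt0 : 0 < K by rewrite !mulr_gt0 ?invr_gt0 ?mulr_gt0.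
have thE rw ro : 0 < 1 - rw ^+ 2 -> 0 < den e q t (1 - rw ^+ 2) ->
    th rw ro = ro ^+ 2 * (K + kappa * ratio rw).
  by move=> u_gt0 den_gt0; apply: theta_formula; rewrite ?gt_eqF.
have near_regular : \forall rw \near rw0,
    [/\ 0 < 1 - rw ^+ 2, 0 < gap q (1 - rw ^+ 2) & 0 < den e q t (1 - rw ^+ 2)].
  have near_u : \forall rw \near rw0, 0 < (1 - 'X^2 : {poly R}).[rw].
    by apply: horner_near_gt0; rewrite !hornerE.
  have near_gap : \forall rw \near rw0, 0 < (gap_poly q).[rw].
    by apply: horner_near_gt0; rewrite gap_polyE.
  have near_den : \forall rw \near rw0, 0 < (den_poly e q t).[rw].
    by apply: horner_near_gt0; rewrite den_polyE.
  near=> rw; split.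
  - suff : 0 < (1 - 'X^2 : {poly R}).[rw] by rewrite !hornerE.
    by near: rw.
  - by rewrite -gap_polyE; near: rw.
  - by rewrite -den_polyE; near: rw.
have slope0 := slope_gt0 p_gt0 c_gt0 e_gt0 q_gt0 t_gt0 u0_gt0 gap0.
pose dratio := 2 * rw0 * slope p c e q t u0 / den e q t u0 ^+ 2.
have d_rw : is_derive rw0 1 (fun rw => th rw ro0) (ro0 ^+ 2 * (kappa * dratio)).
  apply: (@near_eq_is_derive _ _ _ (fun rw => ro0 ^+ 2 * (K + kappa * ratio rw))).
    by apply: filterS near_regular => rw [u_gt0 _ den_gt0]; rewrite thE.
  have d_ratio : is_derive rw0 1 ratio dratio.
    by apply: is_derive_num_div_den; rewrite gt_eqF.
  have -> : (fun rw => ro0 ^+ 2 * (K + kappa * ratio rw))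
            = ro0 ^+ 2 \*: (cst K + kappa \*: ratio) by [].
  by apply: is_derive_eq; rewrite add0r.
have d_ro : is_derive ro0 1 (fun ro => th rw0 ro)
    (2 * ro0 * (K + kappa * ratio rw0)).
  have -> : (fun ro => th rw0 ro)
            = (K + kappa * ratio rw0) \*: (id ^+ 2 : R -> R).
    by apply/funext => ro; rewrite thE // mulrC.
  by apply: is_derive_eq; rewrite /GRing.scale /=; ring.
have ratio_gt0 : 0 < ratio rw0 by rewrite divr_gt0 // addr_gt0 // !mulr_gt0.
split.
- exact: ex_derive.
- exact: ex_derive.
- move=> rw_neq0; rewrite derive1E derive_val.
  have rw_gt0 : 0 < rw0 by rewrite lt_neqAle eq_sym rw_neq0.
  by rewrite !mulr_gt0 ?invr_gt0 ?exprn_gt0.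
- near=> rw.
  have rw_gt : rw0 < rw by near: rw; exact: nbhs_right_gt.
  have [u_gt0 gap_gt0 den_gt0] : [/\ 0 < 1 - rw ^+ 2, 0 < gap q (1 - rw ^+ 2)
      & 0 < den e q t (1 - rw ^+ 2)].
    by near: rw; exact: cvg_within near_regular.
  rewrite !thE // ltr_pM2l ?exprn_gt0 // ltrD2l ltr_pM2l //.
  apply: num_div_den_decreasing => //.
  by rewrite ltrD2l ltrN2 ltr_pXn2r ?nnegrE // (le_trans rw_ge0) ?ltW.
- rewrite derive1E derive_val mulr_ge0 ?(mulr_ge0 _ (ltW ro_gt0)) // ltW //.
  by rewrite addr_gt0 ?(mulr_gt0 kappa_gt0).
Unshelve. all: by end_near.
Qed.

End ThetaMonotone.

Theorem theorem4 (R : realType) (d : measure_display) (T : measurableType d)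
    (P : probability T R) (n r : nat) (n_gt0 : (0 < n)%N) (r_gt0 : (0 < r)%N)
    (mu L sigma_eta sigma_xi alpha : R)
    (f : 'I_n -> 'rV[R]_r -> R) (W : 'M[R]_n)
    (eta xi : nat -> 'I_n -> 'I_r -> {RV P >-> R})
    (s0 x0 : 'M[R]_(n, r)) (s x : nat -> T -> 'M[R]_(n, r))
    (hF : objective_assumption mu L f)
    (hW : weight_assumption W)
    (hEta : noise_assumption sigma_eta eta)
    (hXi : noise_assumption sigma_xi xi)
    (hRun : algorithm_run W f alpha (noise_mx eta) (noise_mx xi) s0 x0 s x)
    (alpha_gt0 : 0 < alpha)
    (alpha_lt : alpha < step_bound mu L (d_I n) (rho_w W)) :
  let th := theta n mu L alpha sigma_eta sigma_xi (d_I n) in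
  [/\ derivable (fun rw => th rw (rho_o W)) (rho_w W) 1,
      derivable (fun ro => th (rho_w W) ro) (rho_o W) 1,
      rho_w W != 0 -> 0 < derive1 (fun rw => th rw (rho_o W)) (rho_w W),
      \forall rw \near (rho_w W)^'+, th (rho_w W) (rho_o W) < th rw (rho_o W)
    & 0 <= derive1 (fun ro => th (rho_w W) ro) (rho_o W)].
Proof.
move=> th.
have mu_gt0 := objective_mu_gt0 hF.
have L_gt0 : 0 < L.
  pose i0 := Ordinal n_gt0.
  exact: lipschitz_constant_gt0 r_gt0 mu_gt0
    (objective_strongly_convex hF i0) (objective_lipschitz hF i0).
have rw_ge0 : 0 <= rho_w W := spectral_radius_ge0 _.
set u0 := 1 - rho_w W ^+ 2.
have u0_gt0 : 0 < u0.
  by rewrite subr_gt0 (expr_lt1 (n := 2) isT rw_ge0) (rho_w_lt1 hW).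
have dI_ge0 : 0 <= d_I n :> R by exact: sqrtr_ge0.
have [dI_gt0 gap0 den0] :=
  step_bound_gap_den mu_gt0 L_gt0 dI_ge0 u0_gt0 alpha_gt0 alpha_lt.
have n_gt1 : (1 < n)%N.
  rewrite ltn_neqAle n_gt0 andbT; apply: contraTneq dI_gt0 => <-.
  by rewrite d_I1 ltxx.
have ro_gt0 : 0 < rho_o W by exact: rho_o_gt0.
apply: theta_monotone; rewrite ?(noise_sigma_gt0 hEta) ?(noise_sigma_gt0 hXi) //.
Qed.
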